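(* Suppose $(X, \tau, <)$ is a GO-space whose underlying LOTS $(X, \lambda, <)$ has a $\sigma$-closed-discrete dense set, and let $Y \subseteq X$. If $(X,\tau)$ is monotonically metacompact, then the subspace $(Y, \tau_Y, <)$ is monotonically metacompact; and if $(X,\tau)$ is monotonically countably metacompact, then the subspace $(Y, \tau_Y, <)$ is monotonically countably metacompact.
   Context: A GO-space (generalized ordered space) is a triple $(X, \tau, <)$ where $<$ is a linear ordering of the set $X$ and $\tau$ is a Hausdorff topology on $X$ that has a base of convex subsets of $(X,<)$, possibly including some singletons. Let $\lambda$ be the usual open interval topology of $<$; then $\lambda \subseteq \tau$ and $(X, \lambda, <)$ is called the underlying LOTS (linearly ordered topological space) of the GO-space. For $Y\subseteq X$, $\tau_Y$ is the subspace topology on $Y$ inherited from $(X,\tau)$. A subset of a space is closed-discrete if every point of the space has a neighborhood containing at most one point of the subset; it is $\sigma$-closed-discrete if it is a countable union of closed-discrete subsets. Here the dense set is dense and $\sigma$-closed-discrete with respect to $\lambda$. For two collections of sets $\mathcal{U}$ and $\mathcal{V}$, write $\mathcal{U} \prec \mathcal{V}$ if for each $U \in \mathcal{U}$ there is some $V \in \mathcal{V}$ with $U \subseteq V$. A space $X$ is monotonically metacompact (respectively, monotonically countably metacompact), in the sense of Popvassilev, if there is a function $r$ that associates with each open cover (respectively, each countable open cover) $\mathcal{U}$ of $X$ a point-finite collection $r(\mathcal{U})$ of open sets that covers $X$ and satisfies $r(\mathcal{U}) \prec \mathcal{U}$, in such a way that if $\mathcal{U}$ and $\mathcal{V}$ are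 open covers (respectively, countable open covers) of $X$ with $\mathcal{U} \prec \mathcal{V}$, then $r(\mathcal{U}) \prec r(\mathcal{V})$. (In the countable version, $r(\mathcal{U})$ is not required to be countable.) *)

(* Defs.v *)
From HB Require Import structures.
From mathcomp Require Import all_boot all_order.
From mathcomp Require Import all_classical topology.

Set Implicit Arguments.
Unset Strict Implicit.
Unset Printing Implicit Defensive.

Local Open Scope classical_set_scope.

(* A GO-space carries two topologies on one ordered set: the order topology of
   the underlying LOTS is that of the library alias [order_topology X], and an
   arbitrary topology [tau] is an explicit family of open sets, turned into a
   topologicalType through the alias [space_of tau]. *)
Record topology_on (T : Type) := Topology {
  opens : set (set T) ;
  opensT : opens setT ;
  opensI : setI_closed opens ;
  opens_bigcup : forall F : set (set T),
    F `<=` opens -> opens (\bigcup_(A in F) A)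
}.

Definition space_of (T : Type) (tau : topology_on T) : Type := T.

Section space_of.
Context (T : choiceType) (tau : topology_on T).

Let opens_bigcupT (I : Type) (f : I -> set T) :
  (forall i, opens tau (f i)) -> opens tau (\bigcup_i f i).
Proof.
move=> tauf; rewrite -(bigcup_image setT f id).
by apply: opens_bigcup => _ [i _ <-].
Qed.

HB.instance Definition _ := Choice.copy (space_of tau) T.
HB.instance Definition _ := isOpenTopological.Build (space_of tau)
  (opensT tau) (@opensI _ tau) opens_bigcupT.

Lemma space_of_open (A : set T) : @open (space_of tau) A = opens tau A.
Proof. by []. Qed.

End space_of.

Definition order_convex d (T : porderType d) (A : set T) : Prop :=
  forall x y z : T, A x -> A z -> (x <= y)%O -> (y <= z)%O -> A y.

Definition is_GO_space d (X : orderType d) (tau : topology_on X) : Prop :=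
  hausdorff_space (space_of tau) /\
  exists2 B : set (set (space_of tau)),
    basis B & forall A : set X, B A -> order_convex A.

Definition closed_discrete (T : topologicalType) (D : set T) : Prop :=
  forall x : T, exists2 N : set T, nbhs x N & is_subset1 (N `&` D).

Definition sigma_closed_discrete (T : topologicalType) (D : set T) : Prop :=
  exists2 F : nat -> set T,
    (forall n, closed_discrete (F n)) & D = \bigcup_n F n.

Definition refines (T : Type) (U V : set (set T)) : Prop :=
  forall A, U A -> exists2 B, V B & A `<=` B.

Definition open_cover (T : topologicalType) (U : set (set T)) : Prop :=
  U `<=` open /\ \bigcup_(A in U) A = setT.

Definition point_finite (T : Type) (U : set (set T)) : Prop :=
  forall x : T, finite_set [set A | U A /\ A x].

(* [r] is total for convenience; only its values on the covers in [C] are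
   constrained. *)
Definition monotone_metacompact_operator (T : topologicalType)
    (C : set (set (set T))) (r : set (set T) -> set (set T)) : Prop :=
  (forall U, C U ->
     [/\ open_cover (r U), point_finite (r U) & refines (r U) U]) /\
  (forall U V, C U -> C V -> refines U V -> refines (r U) (r V)).

Definition monotonically_metacompact (T : topologicalType) : Prop :=
  exists r, monotone_metacompact_operator [set U : set (set T) | open_cover U] r.

Definition monotonically_countably_metacompact (T : topologicalType) : Prop :=
  exists r, monotone_metacompact_operator
    [set U : set (set T) | open_cover U /\ countable U] r.

(* Main.v *)
(* Write R for the points x that are not isolated although [x, ->) is open, and
   L for their mirror images.

   If X is monotonically countably metacompact, then R and L are
   sigma-closed-discrete in the underlying LOTS.  For x in R, the operator
   applied to {(<-, x), [x, ->)} has a member containing some [x, q] with q in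
   a closed-discrete piece E_n of the dense set.  A strictly decreasing sequence
   of such points a_k inside one convex component of X \ E_n would contradict
   point-finiteness at a_0 for the cover {[a_k, ->) : k} u {(<-, a_0)}.  Hence
   these points are well-ordered in each component, and a point of the dense set
   lies between each of them and its successor.

   Conversely, let E = U_n E_n be increasing, dense and contain R and L, with
   each E_n closed-discrete.  The components of X \ E_n, together with the stars
   of the points p of E_n (p and its adjacent components, an adjacent component
   being dropped when p is isolated on that side), form a base at all
   non-isolated points outside R u L and at all points of E.  The traces on Y
   that fit inside a member of a cover and are maximal for this, together with
   the isolated singletons, form the required refinement: the stars containing a
   given point fall into three classes, each decreasing in n, so at most three
   of them are maximal. *)

Require Import Defs.
From mathcomp Require Import all_boot all_order interval.
From mathcomp Require Import all_classical topology.

Import Order.TTheory.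

Set Implicit Arguments.
Unset Strict Implicit.
Unset Printing Implicit Defensive.

Local Open Scope order_scope.
Local Open Scope classical_set_scope.

(** * One-sided closed-discreteness in a linear order *)

Definition left_discrete d (X : orderType d) (D : set X) :=
  forall x y : X, y < x ->
    exists2 a, a < x & forall z, a < z -> z < x -> ~ D z.

(* Closed-discreteness in the order topology, split into one-sided conditions so
   that mirror images come from the dual order [X^d]. *)
Definition order_discrete d (X : orderType d) (D : set X) :=
  @left_discrete d X D /\ @left_discrete _ X^d D.

Definition right_limit d (X : orderType d) (tau : topology_on X) (x : X) :=
  ~ opens tau [set z | z <= x].

Section left_discrete.
Context {d : Order.disp_t} {X : orderType d}.
Implicit Types A B D : set X.

Lemma left_discreteS A B : A `<=` B -> left_discrete B -> left_discrete A.
Proof.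
move=> AB Bd x y /Bd [a ax aB]; exists a => // z az zx /AB.
exact: aB.
Qed.

Lemma left_discrete0 : left_discrete (@set0 X).
Proof. by move=> x y yx; exists y => // z _ _ []. Qed.

Lemma left_discreteU A B :
  left_discrete A -> left_discrete B -> left_discrete (A `|` B).
Proof.
move=> Ad Bd x y yx; have [a ax aA] := Ad x y yx; have [b bx bB] := Bd x y yx.
exists (Order.max a b); first by rewrite gt_max ax.
by move=> z; rewrite gt_max => /andP[az bz] zx [/aA|/bB]; apply.
Qed.

(** An interval [(a, x)] free of [A] holds at most one point of [D]; moving its left end up to that
    point leaves none. *)
Lemma left_discrete_separated A D : left_discrete A ->
  (forall x y, D x -> D y -> x < y -> exists2 e, A e & x <= e <= y) ->
  left_discrete D.
Proof.
move=> Ad DA x y /Ad[a ax aA].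
have [[x1 [ax1 x1x Dx1]]|noD] :=
    pselect (exists x1, [/\ a < x1, x1 < x & D x1]).
  exists x1 => // z x1z zx Dz.
  have [e Ae /andP[x1e ez]] := DA _ _ Dx1 Dz x1z.
  by apply: (aA e) => //; [exact: lt_le_trans x1e|exact: le_lt_trans zx].
by exists a => // z az zx Dz; apply: noD; exists z.
Qed.

End left_discrete.

Section order_discrete.
Context {d : Order.disp_t} {X : orderType d}.
Implicit Types A B D : set X.

Lemma order_discreteS A B : A `<=` B -> order_discrete B -> order_discrete A.
Proof.
move=> AB [Bl Br]; split; first exact: left_discreteS Bl.
exact: (left_discreteS (X := X^d) AB Br).
Qed.

Lemma order_discrete0 : order_discrete (@set0 X).
Proof.
by split; [exact: left_discrete0|exact: (left_discrete0 (X := X^d))].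
Qed.

Lemma order_discreteU A B :
  order_discrete A -> order_discrete B -> order_discrete (A `|` B).
Proof.
move=> [Al Ar] [Bl Br]; split; first exact: left_discreteU.
exact: (left_discreteU (X := X^d) Ar Br).
Qed.

Lemma order_discrete_separated A D : order_discrete A ->
  (forall x y, D x -> D y -> x < y -> exists2 e, A e & x <= e <= y) ->
  order_discrete D.
Proof.
move=> [Al Ar] DA; split; first exact: left_discrete_separated Al DA.
apply: (left_discrete_separated (X := X^d) Ar) => x y Dx Dy yx.
by have [e Ae /andP[ye ex]] := DA y x Dy Dx yx; exists e => //; apply/andP.
Qed.

(** Stage [n] unites the [F i] with code below [n]; each stage adds at most one index, so binary
    unions suffice. *)
Lemma order_discrete_exhaustion (I : countType) (F : I -> set X) :
  (forall i, order_discrete (F i)) ->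
  exists E : nat -> set X,
    [/\ forall n, order_discrete (E n),
        forall m n, (m <= n)%N -> E m `<=` E n &
        \bigcup_n E n = \bigcup_i F i].
Proof.
move=> Fd; pose E n := [set x | exists2 i : I, (pickle i < n)%N & F i x].
exists E; split.
- elim=> [|n IHn]; first by apply: order_discreteS order_discrete0 => x [].
  have [[i iE]|ni] := pselect (exists i : I, pickle i = n).
    apply: order_discreteS (order_discreteU IHn (Fd i)) => x [j].
    rewrite ltnS leq_eqVlt => /orP[/eqP jn|jn] Fj; last by left; exists j.
    by right; rewrite -(pcan_inj pickleK (etrans jn (esym iE))).
  apply: order_discreteS IHn => x [j].
  rewrite ltnS leq_eqVlt => /orP[/eqP jn|jn] Fj; last by exists j.
  by case: ni; exists j.
- by move=> m n mn x [i im Fi]; exists i => //; exact: leq_trans mn.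
- apply/seteqP; split=> x [i]; first by move=> _ [j _ Fj]; exists j.
  by move=> _ Fi; exists (pickle i).+1 => //; exists i.
Qed.

End order_discrete.

(** * GO-topologies: open rays and convex neighbourhoods *)

Lemma opens_local (T : Type) (tau : topology_on T) (P : set T) :
  (forall x, P x -> exists C, [/\ opens tau C, C x & C `<=` P]) -> opens tau P.
Proof.
move=> PC; have -> : P = \bigcup_(C in [set C | opens tau C /\ C `<=` P]) C.
  apply/seteqP; split=> [x /PC[C [oC Cx CP]]|x [C [_ CP] /CP//]].
  by exists C.
by apply: opens_bigcup => C [].
Qed.

(** The form in which the GO-condition is used, mirrored through [X^d]. *)
Definition ray_convex_opens d (X : orderType d) (tau : topology_on X) :=
  [/\ forall y : X, opens tau [set z | z < y],
      forall y : X, opens tau [set z | y < z] &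
      forall O x, opens tau O -> O x ->
        exists B, [/\ opens tau B, B x, B `<=` O & order_convex B]].

Lemma ray_convex_opens_dual d (X : orderType d) (tau : topology_on X) :
  ray_convex_opens tau -> @ray_convex_opens _ X^d tau.
Proof.
move=> [lo hi cv]; split; [exact: hi|exact: lo|move=> O x oO Ox].
have [B [oB Bx BO cB]] := cv O x oO Ox; exists B; split => //.
by move=> u v w Bu Bw uv vw; exact: (cB w v u Bw Bu vw uv).
Qed.

(** Separate [x] from [y] by disjoint [C] and [D] with [C] convex: reaching across [y], [C] would
    contain [y], which lies in [D]. *)
Lemma GO_space_ray_convex_opens d (X : orderType d) (tau : topology_on X) :
  is_GO_space tau -> ray_convex_opens tau.
Proof.
move=> [hT [B [Bo Bb] Bc]].
have cvx (O : set (space_of tau)) x : open O -> O x ->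
    exists C, [/\ opens tau C, C x, C `<=` O & order_convex C].
  move=> oO Ox; have [C [BC Cx] CO] := Bb x O (open_nbhs_nbhs (conj oO Ox)).
  by exists C; split => //; [exact: Bo|exact: Bc].
have sep (x y : X) : x != y -> exists C D : set X,
    [/\ opens tau C, C x, order_convex C, D y & C `&` D = set0].
  move=> xy; move: hT; rewrite open_hausdorff => /(_ x y xy)[[P Q] /=].
  rewrite !inE => -[Px Qy] [oP oQ PQ].
  have [C [oC Cx CP cC]] := cvx P x oP Px.
  have [D [oD Dy DQ cD]] := cvx Q y oQ Qy.
  by exists C, D; split => //; exact: subsetI_eq0 PQ.
split=> [y|y|]; last exact: cvx.
- apply: opens_local => x /= xy.
  have [|C [D [oC Cx cC Dy CD]]] := sep x y; first by rewrite lt_eqF.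
  exists C; split => // z Cz /=; rewrite ltNge; apply/negP => yz.
  suff : set0 y by [].
  by rewrite -CD; split => //; apply: (cC x y z) => //; exact: ltW.
- apply: opens_local => x /= xy.
  have [|C [D [oC Cx cC Dy CD]]] := sep x y; first by rewrite gt_eqF.
  exists C; split => // z Cz /=; rewrite ltNge; apply/negP => yz.
  suff : set0 y by [].
  by rewrite -CD; split => //; apply: (cC z y x) => //; exact: ltW.
Qed.

(** * Closed-discrete and dense sets of the underlying LOTS *)

Lemma left_discrete_subset1 d (X : orderType d) (D : set X) :
  (forall x y : X, y < x ->
    exists2 a, a < x & is_subset1 ([set z | a < z < x] `&` D)) ->
  left_discrete D.
Proof.
move=> D1 x y /D1[a ax aD].
have [[z [az zx Dz]]|nz] := pselect (exists z, [/\ a < z, z < x & D z]).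
  exists z => // w zw wx Dw; move: (zw); rewrite (aD z w) ?ltxx//.
    by split=> //=; rewrite az.
  by split=> //=; rewrite wx (lt_trans az zw).
by exists a => // z az zx Dz; apply: nz; exists z.
Qed.

Lemma order_nbhs_interval d (X : orderType d) (x : order_topology X)
    (N : set (order_topology X)) : nbhs x N ->
  exists i : interval X, [/\ itv_open_ends i, (x : X) \in i &
    forall z : X, z \in i -> N z].
Proof. by rewrite order_nbhs_itv => -[i [io xi] iN]; exists i. Qed.

Lemma closed_discrete_order_discrete d (X : orderType d)
    (D : set (order_topology X)) :
  closed_discrete D -> @order_discrete d X D.
Proof.
move=> Dd; split; apply: left_discrete_subset1 => x y yx; have [N] := Dd x;
  move=> /order_nbhs_interval[i [io xi iN]] ND1.
- suff [a ax ai] : exists2 a : X, a < x & forall z : X, a < z < x -> z \in i.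
    exists a => // u v [ux Du] [vx Dv].
    by apply: ND1; split=> //; apply: iN; exact: ai.
  case: i io xi {iN} => [[[]l|[]] [[]u|[]]] // _; rewrite in_itv/= => xi.
  + exists l; [by case/andP: xi|move=> z /andP[lz zx]].
    by rewrite in_itv/= lz (lt_trans zx)//; case/andP: xi.
  + rewrite andbT in xi; exists l => // z /andP[lz _].
    by rewrite in_itv/= lz.
  + by exists y => // z /andP[_ zx]; rewrite in_itv/= (lt_trans zx).
  + by exists y => // z _; rewrite in_itv.
- suff [b xb bi] : exists2 b : X, (x : X) < b &
      forall z : X, (x : X) < z < b -> z \in i.
    exists b; first exact: xb.
    move=> u v [/andP[bu ux] Du] [/andP[bv vx] Dv].
    by apply: ND1; split=> //; apply: iN; apply: bi; apply/andP; split.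
  case: i io xi {iN} => [[[]l|[]] [[]u|[]]] // _; rewrite in_itv/= => xi.
  + exists u; [by case/andP: xi|move=> z /andP[xz zu]].
    by rewrite in_itv/= zu (lt_trans _ xz)//; case/andP: xi.
  + rewrite andbT in xi; exists y => // z /andP[xz _].
    by rewrite in_itv/= (lt_trans _ xz).
  + by exists u => // z /andP[_ zu]; rewrite in_itv.
  + by exists y => // z _; rewrite in_itv.
Qed.

Lemma dense_between d (X : orderType d) (D : set (order_topology X)) :
  dense D -> forall a b c : X, a < c -> c < b ->
  exists2 e : X, D e & a < e < b.
Proof.
move=> Dd a b c ac cb.
have [|e [/= eab De]] := Dd `]a, b[%classic _ (itv_open _ _).
  by exists c; rewrite /= in_itv/= ac.
by exists e => //; move: eab; rewrite in_itv.
Qed.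

(** * The set R in a monotonically countably metacompact space *)

Definition right_point d (X : orderType d) (tau : topology_on X) (x : X) :=
  opens tau [set z | x <= z] /\ ~ opens tau [set x].

Section right_points.
Context {d : Order.disp_t} {X : orderType d} (tau : topology_on X).
Hypothesis tauP : ray_convex_opens tau.

Variable r : set (set X) -> set (set X).
Hypothesis rP : monotone_metacompact_operator (T := space_of tau)
  [set U | open_cover U /\ countable U] r.

Definition split_cover (x : X) : set (set X) :=
  [set [set z | z < x]; [set z | x <= z]].

Definition captures (x q : X) :=
  exists2 W, r (split_cover x) W & forall z, x <= z <= q -> W z.

Lemma split_cover_open x : opens tau [set z | x <= z] ->
  open_cover (T := space_of tau) (split_cover x) /\ countable (split_cover x).
Proof.
have [lo _ _] := tauP => ox; split; last first.
  exact: finite_set_countable (finite_set2 _ _).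
split=> [A [->|->] //|]; first exact: lo.
apply/seteqP; split=> // z _; have [zx|xz] := ltP z x.
  by exists [set z | z < x] => //; left.
by exists [set z | x <= z] => //; right.
Qed.

Lemma finite_bound (T : Type) (P : T -> nat -> Prop) (S : set T) :
  finite_set S -> (forall t, S t -> exists k, forall j, (k < j)%N -> ~ P t j) ->
  exists K, forall t, S t -> ~ P t K.
Proof.
elim/Pchoice: T => T in P S *.
move=> /finite_seqP[s ->] sP.
suff [K KP] : exists K, forall t, t \in s -> forall j, (K < j)%N -> ~ P t j.
  by exists K.+1 => t /KP; apply.
elim: s sP => [|t s IHs] sP; first by exists 0%N.
have [|K KP] := IHs; first by move=> u us; apply: sP; rewrite /= inE us orbT.
have [|k kP] := sP t; first by rewrite /= inE eqxx.
exists (maxn K k) => u; rewrite inE => /orP[/eqP ->|us] j; rewrite gtn_max.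
  by case/andP=> _; exact: kP.
by case/andP=> + _; exact: KP.
Qed.

(** By monotonicity each [a k] shares a member of [r V] with [a 0]. Finitely many members contain
    [a 0], each inside some [[a k, ->)], so a late term escapes them all. *)
Lemma no_decreasing_captured (a : nat -> X) :
  (forall k, opens tau [set z | a k <= z]) -> (forall k, a k.+1 < a k) ->
  (forall k, captures (a k) (a 0%N)) -> False.
Proof.
move=> ao ad ac; have [lo _ _] := tauP; case: rP => rC rM.
have aD j k : (j < k)%N -> a k < a j.
  elim: k => // k IHk; rewrite ltnS leq_eqVlt => /orP[/eqP -> //|jk].
  exact: lt_trans (ad _) (IHk jk).
have a0 k : a k <= a 0%N by case: k => // k; exact/ltW/aD.
pose V : set (set X) :=
  range (oapp (fun k => [set z | a k <= z]) [set z | z < a 0%N]).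
have CV : open_cover (T := space_of tau) V /\ countable V.
  split; last exact: sub_countable (card_image_le _ _) (countableP _).
  split=> [_ [[k|] _ <-]|]; [exact: ao|exact: lo|].
  apply/seteqP; split=> // z _; have [za|az] := ltP z (a 0%N).
    by exists [set z | z < a 0%N] => //; exists None.
  by exists [set z | a 0%N <= z] => //; exists (Some 0%N).
have [_ /(_ (a 0%N)) Vfin Vref] := rC _ CV.
have [] := @finite_bound _ (fun G k => G (a k)) _ Vfin.
  move=> G [rG Ga0]; have [_ [[k|] _ <-] GB] := Vref _ rG.
    by exists k => j kj /GB /=; rewrite leNgt aD.
  by have /= := GB _ Ga0; rewrite ltxx.
move=> K KG; have [W rW WP] := ac K.
have [|G rG WG] := rM _ _ (split_cover_open (ao K)) CV _ _ rW.
  move=> A [->|->]; last by exists [set z | a K <= z] => //; exists (Some K).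
  exists [set z | z < a 0%N]; first by exists None.
  by move=> z /= /lt_le_trans; apply.
have aK0 := a0 K.
apply: (KG G); last by apply/WG/WP; rewrite lexx.
by split=> //; apply/WG/WP; rewrite lexx aK0.
Qed.

Variable E : nat -> set X.
Hypothesis E_discrete : forall n, order_discrete (E n).
Hypothesis E_between : forall a b c : X, a < c -> c < b ->
  exists2 e, (\bigcup_n E n) e & a < e < b.

Definition E_free n (x y : X) := forall e, E n e -> ~ (x <= e <= y).

Definition reaches n (x : X) :=
  right_point tau x /\ exists2 q, E n q & x < q /\ captures x q.

(** The point [e] lies between [x] and its successor among the reaching points not cut off from [x]
    by the first level; the second index records the level of [e]. *)
Definition right_piece (nm : nat * nat) := [set x : X | reaches nm.1 x /\
  exists2 e, E nm.2 e & x < e /\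
    forall y, reaches nm.1 y -> x < y -> E_free nm.1 x y -> e < y].

(** Two points of a piece are separated by a point of the first level or else by the witness [e] of
    the smaller one. *)
Lemma right_piece_discrete nm : order_discrete (right_piece nm).
Proof.
apply: order_discrete_separated (order_discreteU (E_discrete nm.1)
  (E_discrete nm.2)) _ => x y [_ [e Ee [xe eP]]] [ry _] xy.
have [[f Ef xfy]|nf] := pselect (exists2 f, E nm.1 f & x <= f <= y).
  by exists f => //; left.
exists e; [by right|rewrite (ltW xe) (ltW (eP _ ry xy _))//].
by move=> f Ef xfy; apply: nf; exists f.
Qed.

Lemma right_point_next x (b : X) : right_point tau x -> x < b ->
  exists c, x < c < b.
Proof.
have [lo _ _] := tauP => -[ox nx] xb; apply: contrapT => ncb; apply: nx.
have -> : [set x] = [set z | x <= z] `&` [set z | z < b].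
  apply/seteqP; split=> [z ->|z [/= xz zb]]; first by split=> /=.
  apply/eqP; rewrite eq_le xz leNgt andbT; apply/negP => xlz.
  by apply: ncb; exists z; rewrite xlz.
by apply: opensI.
Qed.

Lemma right_point_between x (b : X) : right_point tau x -> x < b ->
  exists n e, E n e /\ x < e < b.
Proof.
move=> rx /(right_point_next rx)[c /andP[xc cb]].
by have [e [n _ Ee] xeb] := E_between xc cb; exists n, e.
Qed.

(** A member containing [x] lies in [[x, ->)]. Its convex neighbourhood of the non-isolated [x]
    extends above [x], and a point of some [E n] fits in between. *)
Lemma right_point_reaches x : right_point tau x -> exists n, reaches n x.
Proof.
move=> rx; have [ox nx] := rx; have [lo _ cv] := tauP; case: rP => rC _.
have [[ro rcov] _ rref] := rC _ (split_cover_open ox).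
have [W rW Wx] : (\bigcup_(W in r (split_cover x)) W) x by rewrite rcov.
have Wle z : W z -> x <= z.
  have [_ [->|->] WB] := rref _ rW; last exact: WB.
  by have := WB _ Wx; rewrite /= ltxx.
have [B [oB Bx BW cB]] := cv _ _ (ro _ rW) Wx.
have [[b Bb xb]|nb] := pselect (exists2 b, B b & x < b); last first.
  case: nx; suff <- : B = [set x] by [].
  apply/seteqP; split=> [z Bz|_ ->//]; apply/eqP.
  have := Wle _ (BW _ Bz); rewrite le_eqVlt eq_sym => /orP[//|xz].
  by case: nb; exists z.
have [n [e [Ee /andP[xe eb]]]] := right_point_between rx xb.
exists n; split=> //; exists e => //; split=> //; exists W => // z /andP[xz ze].
by apply/BW/(cB x z b) => //; exact: le_trans (ltW eb).
Qed.

Lemma captures_le x p q : p <= q -> captures x q -> captures x p.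
Proof.
move=> pq [W rW WP]; exists W => // z /andP[xz zp]; apply: WP.
by rewrite xz (le_trans zp).
Qed.

(** Without a least such point, choice gives a strictly decreasing sequence from [y], which
    [no_decreasing_captured] excludes. *)
Lemma reaches_min n x y : reaches n y -> x < y -> E_free n x y ->
  exists y0, [/\ reaches n y0, x < y0, E_free n x y0 &
    forall z, reaches n z -> x < z -> E_free n x z -> y0 <= z].
Proof.
move=> ry xy xyf; apply: contrapT => nomin.
pose A := [set z | [/\ reaches n z, x < z & E_free n x z]].
have /choice[g gP] : forall z, exists w, A z -> A w /\ w < z.
  move=> z; have [Az|nAz] := pselect (A z); last by exists z.
  apply: contrapT => now; apply: nomin; case: Az => rz xz fz.
  exists z; split=> // w rw xw fw; rewrite leNgt; apply/negP => wz.
  by apply: now; exists w => _; split.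
pose a k := iter k g y.
have aA k : A (a k) by elim: k => [|k /gP[]].
apply: (no_decreasing_captured (a := a)) => k.
- by have [[[]]] := aA k.
- by have [] := gP _ (aA k).
(* The point [q] of [E n] lies above [x], while [[x, y]] is free of [E n]; so [q] is not below [y],
   which is [a 0], and [a 0] is captured too. *)
have [[_ [q Eq [akq aq]]] xak _] := aA k.
apply: captures_le aq; rewrite leNgt; apply/negP => qy.
by apply: (xyf q) => //; rewrite (ltW (lt_trans xak akq)) ltW.
Qed.

Lemma right_point_piece x : right_point tau x -> exists nm, right_piece nm x.
Proof.
move=> rx; have [n rnx] := right_point_reaches rx.
have [[y [ry xy xyf]]|none] :=
    pselect (exists y, [/\ reaches n y, x < y & E_free n x y]).
  have [y0 [ry0 xy0 _ y0min]] := reaches_min ry xy xyf.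
  have [m [e [Ee /andP[xe ey0]]]] := right_point_between rx xy0.
  exists (n, m); split=> //=; exists e => //; split=> // z rz xz fz.
  exact: lt_le_trans (y0min _ rz xz fz).
(* No later point has to be separated, so [q] itself serves as [e]. *)
have [_ [q Eq [xq _]]] := rnx; exists (n, n); split=> //; exists q => //=.
by split=> // y ry xy xyf; case: none; exists y.
Qed.

End right_points.

Lemma right_points_discrete d (X : orderType d) (tau : topology_on X)
    (E : nat -> set X) :
  ray_convex_opens tau -> (forall n, order_discrete (E n)) ->
  (forall a b c : X, a < c -> c < b ->
    exists2 e, (\bigcup_n E n) e & a < e < b) ->
  monotonically_countably_metacompact (space_of tau) ->
  exists F : nat * nat -> set X, (forall nm, order_discrete (F nm)) /\
    [set x | right_point tau x] `<=` \bigcup_nm F nm.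
Proof.
move=> tauP Ed Eb [r rP].
exists (right_piece tau r E); split=> [nm|x rx].
  exact: right_piece_discrete.
by have [nm Fx] := right_point_piece tauP rP Eb rx; exists nm.
Qed.


(** * Monotone metacompactness from a base with finitely many nested classes at each point *)

Section nested_base.
Context (S : topologicalType) (I : finType).
Variables (B : nat -> set (set S)) (cls : S -> I -> nat -> set (set S)).
Hypothesis B_open : forall n G, B n G -> open G.
Hypothesis B_base : forall x O, open O -> O x -> ~ open [set x] ->
  exists n G, [/\ B n G, G x & G `<=` O].
Hypothesis B_cls : forall x n G, B n G -> G x -> exists i, cls x i n G.
Hypothesis cls_nested : forall x i k n G H,
  cls x i k G -> cls x i n H -> (k <= n)%N -> H `<=` G.

Let small (U : set (set S)) (G : set S) := exists2 V, U V & G `<=` V.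

(** Maximality is tested against earlier levels alone; equal levels are settled by the nesting of
    the classes. *)
Let first_small U n G := [/\ B n G, small U G &
  forall m H, (m < n)%N -> B m H -> G `<=` H -> ~ small U H].

Let isolated_sets : set (set S) := [set [set x] | x in [set x | open [set x]]].

Let refinement U := isolated_sets `|` [set G | exists n, first_small U n G].

Let first_small_above U n G : B n G -> small U G ->
  exists2 H, G `<=` H & exists m, first_small U m H.
Proof.
elim/ltn_ind: n G => n IHn G BG sG.
have [[m [H [mn BH GH sH]]]|nm] := pselect (exists m H,
    [/\ (m < n)%N, B m H, G `<=` H & small U H]).
  have [H' HH' fH'] := IHn _ mn _ BH sH; exists H' => //.
  exact: subset_trans HH'.
by exists G => //; exists n; split=> // m H mn BH GH sH; apply: nm; exists m, H.
Qed.

(** Nesting puts the set of the later level inside the other, so it was not first; at equal levels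
    the inclusions go both ways. *)
Let first_small_class_subset1 U x i :
  is_subset1 [set G | exists n, first_small U n G /\ cls x i n G].
Proof.
move=> G H [k [fG cG]] [n [fH cH]].
wlog kn : G H k n fG cG fH cH / (k <= n)%N => [th|].
  by have [kn|/ltnW nk] := leqP k n; [exact: th kn|apply/esym; exact: th nk].
have HG := cls_nested cG cH kn.
move: kn; rewrite leq_eqVlt => /orP[/eqP kn|kn].
  rewrite kn in cG; apply/seteqP; split=> //.
  exact: cls_nested cH cG (leqnn _).
have [BG sG _] := fG; have [_ _ /(_ k G kn BG HG)] := fH.
by [].
Qed.

Lemma nested_base_monotonically_metacompact : monotonically_metacompact S.
Proof.
exists refinement; split=> [U [Uo Ucov]|U V [_ _] [_ Vcov] UV]; last first.
  (* Isolated singletons do not depend on the cover, and a set small for [U] is small for [V]. *)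
  move=> G [iG|[n [BG [W UW GW] _]]]; first by exists G => //; left.
  have [W' VW' WW'] := UV _ UW.
  have [|H GH fH] := first_small_above BG (U := V).
    by exists W' => //; exact: subset_trans WW'.
  by exists H => //; right.
split.
- split=> [G [[x ox <-]|[n [/B_open]]]//|].
  apply/seteqP; split=> // x _.
  have [V UV Vx] : (\bigcup_(V in U) V) x by rewrite Ucov.
  have [ox|nox] := pselect (open [set x]).
    by exists [set x] => //; left; exists x.
  have [n [G [BG Gx GV]]] := B_base (Uo _ UV) Vx nox.
  have [|H GH fH] := first_small_above BG (U := U); first by exists V.
  by exists H; [right|exact: GH].
- move=> x; apply: (@sub_finite_set _ _ ([set [set x]] `|`
    \bigcup_(i in [set: I]) [set G |
      exists n, first_small U n G /\ cls x i n G])).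
    move=> G [[[y _ <-]|[n fG]] Gx]; [by left; rewrite (Gx : x = y)|right].
    have [BG _ _] := fG; have [i cG] := B_cls BG Gx.
    by exists i => //; exists n.
  rewrite finite_setU; split=> //; apply: bigcup_finite => // i _.
  have [->//|/set0P[G PG]] :=
    eqVneq [set G | exists n, first_small U n G /\ cls x i n G] set0.
  apply: (@sub_finite_set _ _ [set G]) => // H PH.
  exact: first_small_class_subset1 PH PG.
- move=> G [[x _ <-]|[n [_ [V UV GV] _]]]; last by exists V.
  have [V UV Vx] : (\bigcup_(V in U) V) x by rewrite Ucov.
  by exists V => // _ ->.
Qed.

End nested_base.

(** * Arms and stars *)

(* When [p] lies outside [E n], its two arms fill up the convex component of [p]
   in the complement of [E n]. *)
Definition arm d (X : orderType d) (tau : topology_on X) (E : nat -> set X)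
    (n : nat) (p : X) : set X :=
  [set y | [/\ p < y, forall e, E n e -> p < e -> y < e &
    E n p -> right_limit tau p]].

Definition star d (X : orderType d) (tau : topology_on X) (E : nat -> set X)
    (n : nat) (p : X) : set X :=
  p |` (arm tau E n p `|` @arm _ X^d tau E n p).

(** Reversing the order swaps the arms; this carries results on right arms over to left arms. *)
Lemma star_dual d (X : orderType d) (tau : topology_on X) (E : nat -> set X) :
  @star _ X^d tau E = star tau E.
Proof.
by apply/funext => n; apply/funext => p; rewrite /star [X in _ |` X]setUC.
Qed.

Section arm.
Context {d : Order.disp_t} {X : orderType d} (tau : topology_on X).
Variable E : nat -> set X.
Hypothesis tauP : ray_convex_opens tau.
Hypothesis E_mono : forall m n, (m <= n)%N -> E m `<=` E n.

Lemma arm_antimono k n p : (k <= n)%N -> arm tau E n p `<=` arm tau E k p.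
Proof.
move=> kn y [py yE pE]; split=> // [e Ee|Ep]; last by apply/pE/(E_mono kn).
exact/yE/(E_mono kn).
Qed.

Lemma arm_right_nbhs n y : left_discrete (X := X^d) (E n) ->
  exists O, [/\ opens tau O, O y &
    forall z e, O z -> E n e -> y < e -> z < e].
Proof.
move=> Ed; have [lo _ _] := tauP.
have [[b yb]|nb] := pselect (exists b, y < b); last first.
  exists setT; split=> //; first exact: opensT.
  by move=> z e _ _ ye; case: nb; exists e.
have [a ya aE] := Ed y b yb.
exists [set z : X | z < a]; split=> // z e /= za Ee ye.
rewrite (lt_le_trans za)// leNgt; apply/negP => ea.
exact: (aE e).
Qed.

Lemma arm_open_point n p y : order_discrete (E n) -> arm tau E n p y ->
  exists O, [/\ opens tau O, O y & O `<=` arm tau E n p].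
Proof.
move=> [_ Er] [py yE pE]; have [_ hi _] := tauP.
have [O [oO Oy OE]] := arm_right_nbhs y Er.
exists (O `&` [set z | p < z]); split=> [|//|z [Oz pz]].
  by apply: opensI.
by split=> // e Ee pe; apply: OE => //; exact: yE.
Qed.

Lemma arm_center_nbhs n p : left_discrete (X := X^d) (E n) ->
  exists O, [/\ opens tau O, O p & forall z, O z -> p < z -> arm tau E n p z].
Proof.
move=> Er; have [O [oO Op OE]] := arm_right_nbhs p Er.
have [[Ep cl]|acc] := pselect (E n p /\ opens tau [set z | z <= p]).
  exists [set z | z <= p]; split=> //= z zp pz.
  by move: (le_lt_trans zp pz); rewrite ltxx.
exists O; split=> // z Oz pz; split=> // [e|Ep cl]; first exact: OE.
exact: acc.
Qed.

(** If [x] is isolated on the right, its arm is empty once [x] is in [E m]. Otherwise a convex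
    neighbourhood contains some [b] above [x], and a point of [E] strictly between cuts the arm
    off. *)
Lemma arm_base (x : X) O :
  (forall a b c : X, a < c -> c < b ->
    exists2 e, (\bigcup_n E n) e & a < e < b) ->
  (\bigcup_n E n) x \/ right_limit tau x -> opens tau O -> O x ->
  exists n, forall m, (n <= m)%N -> arm tau E m x `<=` O.
Proof.
move=> Eb Ex oO Ox; have [lo _ cv] := tauP.
have [cl|acc] := pselect (opens tau [set z | z <= x]).
  case: Ex => [[n _ Ex]|//]; exists n => m nm y [_ _ /(_ (E_mono nm Ex))].
  by case.
have [B [oB Bx BO cB]] := cv O x oO Ox.
have [b Bb xb] : exists2 b, B b & x < b.
  apply: contrapT => nb; apply: acc.
  have -> : [set z | z <= x] = B `|` [set z | z < x].
    apply/seteqP; split=> [z /=|z [Bz|/ltW//]].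
      by rewrite le_eqVlt => /orP[/eqP ->|]; [left|right].
    by rewrite /= leNgt; apply/negP => xz; apply: nb; exists z.
  exact: (@openU (space_of tau) _ _ oB (lo x)).
have [c /andP[xc cb]] : exists c, x < c < b.
  apply: contrapT => nc; apply: acc.
  suff -> : [set z | z <= x] = [set z | z < b] by [].
  apply/seteqP; split=> z /=; first by move=> /le_lt_trans; apply.
  move=> zb; rewrite leNgt; apply/negP => xz.
  by apply: nc; exists z; rewrite xz.
have [e [n _ Ee] /andP[xe eb]] := Eb _ _ _ xc cb.
exists n => m nm y [xy /(_ e (E_mono nm Ee) xe) ye _]; apply: BO.
by apply: (cB x y b) => //; apply: ltW => //; exact: lt_trans eb.
Qed.

(** As [p] is in [E n], it cannot lie between [q] and [x], so [p <= q]. If [p < q], the star of [q]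
    stays above [p] and below the points of [E k] beyond [x], hence lies in the arm of [p]. *)
Lemma arm_nested k n p q x : (k <= n)%N -> E k p -> E n q ->
  arm tau E k p x -> arm tau E n q x -> star tau E n q `<=` star tau E k p.
Proof.
move=> kn Ep Eq [px xp accp] [qx xq accq].
have pq : p <= q.
  rewrite leNgt; apply/negP => qp.
  by move: (xq _ (E_mono kn Ep) qp); rewrite ltNge (ltW px).
move: pq; rewrite le_eqVlt => /orP[/eqP <-|pq].
  move=> y [->|[ya|ya]]; [by left|right; left; exact: arm_antimono ya|].
  right; right; case: ya => py yE pE; split=> // [e Ee|_].
    exact/yE/(E_mono kn).
  exact/pE/(E_mono kn).
have nEq : ~ E k q by move=> /xp/(_ pq); rewrite ltNge (ltW qx).
have py y : star tau E n q y -> p < y.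
  move=> [->//|[[qy _ _]|[yq yE _]]]; first exact: lt_trans qy.
  by apply: (yE p) => //; exact: (E_mono kn).
move=> y sy; right; left; split=> // [|e Ee pe]; first exact: py.
have xe := xp _ Ee pe; have qe := lt_trans qx xe.
case: sy => [->//|[[_ yE _]|[yq _ _]]]; first exact/yE/qe/(E_mono kn).
exact: lt_trans qe.
Qed.

(** No point of [E n] lies in [[p, x]], so both points have the same points of [E n] on either
    side. *)
Lemma star_component_sub n p x : ~ E n p -> arm tau E n p x ->
  star tau E n p `<=` star tau E n x.
Proof.
move=> nEp [px xE _].
have nEx : ~ E n x by move=> /xE/(_ px); rewrite ltxx.
have gap e : E n e -> e < x -> e < p.
  move=> Ee ex; rewrite ltNge le_eqVlt; apply/negP => /orP[/eqP pe|pe].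
    by rewrite pe in nEp.
  by move: (xE _ Ee pe); rewrite ltNge (ltW ex).
move=> y sy.
have up e : E n e -> x < e -> y < e.
  move=> Ee xe; have pe := lt_trans px xe.
  case: sy => [->//|[[_ yE _]|[yp _ _]]]; first exact: yE.
  exact: lt_trans pe.
have down e : E n e -> e < x -> e < y.
  move=> Ee /(gap _ Ee) ep.
  case: sy => [->//|[[py _ _]|[yp yE _]]]; first exact: lt_trans py.
  exact: yE.
have [xy|yx|->] := ltgtP x y; [right; left|right; right|by left].
  by split.
by split.
Qed.

End arm.

Lemma star_component d (X : orderType d) (tau : topology_on X)
    (E : nat -> set X) n (p x : X) :
  ~ E n p -> arm tau E n p x -> star tau E n p = star tau E n x.
Proof.
move=> nEp px; apply/seteqP; split; first exact: star_component_sub.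
have [xp xE _] := px.
have nEx : ~ E n x by move=> /xE/(_ xp); rewrite ltxx.
rewrite -star_dual; apply: (star_component_sub (X := X^d)) => //.
split=> // e Ee ex; rewrite ltNge le_eqVlt; apply/negP => /orP[/eqP ep|pe].
  by rewrite ep in Ee.
by move: (xE _ Ee pe); rewrite ltNge (ltW (ex : (e : X) < x)).
Qed.

(** * Stars as a base, and their three classes *)

Section star.
Context {d : Order.disp_t} {X : orderType d} (tau : topology_on X).
Variable E : nat -> set X.
Hypothesis tauP : ray_convex_opens tau.
Hypothesis E_mono : forall m n, (m <= n)%N -> E m `<=` E n.
Hypothesis E_discrete : forall n, order_discrete (E n).

Let tauP' := ray_convex_opens_dual tauP.

Lemma star_open n p : opens tau (star tau E n p).
Proof.
apply: opens_local => y [->|[yp|yp]].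
- have [O [oO Op OE]] := arm_center_nbhs tauP p (E_discrete n).2.
  have [O' [oO' O'p O'E]] :=
    arm_center_nbhs (X := X^d) tauP' p (E_discrete n).1.
  exists (O `&` O'); split=> [|//|z [Oz O'z]]; first exact: opensI.
  have [pz|zp|->] := ltgtP p z; last by left.
    by right; left; exact: OE.
  by right; right; exact: O'E.
- have [O [oO Oy OE]] := arm_open_point tauP (E_discrete n) yp.
  by exists O; split=> // z Oz; right; left; exact: OE.
- have [El Er] := E_discrete n.
  have [O [oO Oy OE]] := arm_open_point (X := X^d) tauP' (conj Er El) yp.
  by exists O; split=> // z Oz; right; right; exact: OE.
Qed.

Lemma star_antimono k n p : (k <= n)%N -> star tau E n p `<=` star tau E k p.
Proof.
move=> kn y [->|[ya|ya]]; [by left|right; left|right; right].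
  exact: arm_antimono ya.
exact: (arm_antimono (X := X^d)) ya.
Qed.

Lemma star_base x O :
  (forall a b c : X, a < c -> c < b ->
    exists2 e, (\bigcup_n E n) e & a < e < b) ->
  (\bigcup_n E n) x \/
    right_limit tau x /\ right_limit (X := X^d) tau x ->
  opens tau O -> O x -> exists n, star tau E n x `<=` O.
Proof.
move=> Eb Ex oO Ox.
have [|m mO] := arm_base tauP E_mono Eb _ oO Ox.
  by case: Ex => [|[]]; auto.
have [||n nO] := arm_base (X := X^d) tauP' E_mono _ _ oO Ox.
- move=> a b c ac cb; have [e Ee /andP[be ea]] := Eb _ _ _ cb ac.
  by exists e => //; apply/andP.
- by case: Ex => [|[]]; auto.
exists (maxn m n) => y [->//|[]].
  by apply: mO; exact: leq_maxl.
by apply: nO; exact: leq_maxr.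
Qed.

(** [None] is the star of [x] itself; the other two classes are the stars centred in [E n] with [x]
    in the right or left arm. *)
Definition star_class (x : X) (i : option bool) n (G : set X) :=
  match i with
  | None => G = star tau E n x
  | Some true => exists2 p, G = star tau E n p & E n p /\ arm tau E n p x
  | Some false =>
      exists2 p, G = star tau E n p & E n p /\ arm (X := X^d) tau E n p x
  end.

(** A star centred outside [E n] is a whole component, hence also the star of [x]. *)
Lemma star_classified n p x : star tau E n p x ->
  exists i, star_class x i n (star tau E n p).
Proof.
move=> [->|]; first by exists None.
have [Ep|nEp] := pselect (E n p).
  by move=> [px|px]; [exists (Some true)|exists (Some false)]; exists p.
move=> px; exists None; rewrite /=; case: px; first exact: star_component.
by move=> px; rewrite -star_dual; exact: (star_component (X := X^d)).
Qed.

Lemma star_class_nested x i k n G H : star_class x i k G ->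
  star_class x i n H -> (k <= n)%N -> H `<=` G.
Proof.
case: i => [[]|] /=; last by move=> -> -> kn; exact: star_antimono.
  by move=> [p -> [Ep px]] [q -> [Eq qx]] kn; exact: arm_nested qx.
move=> [p -> [Ep px]] [q -> [Eq qx]] kn; rewrite -star_dual.
exact: (arm_nested (X := X^d)) qx.
Qed.

Lemma subspace_monotonically_metacompact (Y : set (space_of tau)) :
  (forall a b c : X, a < c -> c < b ->
    exists2 e, (\bigcup_n E n) e & a < e < b) ->
  right_point tau `<=` \bigcup_n E n ->
  right_point (X := X^d) tau `<=` \bigcup_n E n ->
  monotonically_metacompact (set_type Y).
Proof.
move=> Eb Er El.
pose tr (G : set X) : set (set_type Y) := (set_val : _ -> space_of tau) @^-1` G.
apply: (@nested_base_monotonically_metacompact _ (option bool)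
  (fun n G => exists p, G = tr (star tau E n p))
  (fun x i n G => exists2 H, G = tr H & star_class (set_val x) i n H)).
- by move=> n _ [p ->]; exists (star tau E n p) => //; exact: star_open.
- move=> x _ [O oO <-] Ox nx.
  have nvx : ~ opens tau [set set_val x].
    move=> ox; apply: nx; exists [set set_val x] => //.
    apply/seteqP; split=> [y /= /val_inj ->//|_ -> //].
  have [n nO] : exists n, star tau E n (set_val x) `<=` O.
    apply: star_base => //.
    have [|nE] := pselect ((\bigcup_n E n) (set_val x)); first by left.
    (* If [(<-, x]] or [[x, ->)] were open, the non-isolated point would belong to L or R, hence to
       [E]. *)
    right; split=> cx; apply: nE.
      exact: El.
    exact: Er.
  by exists n, (tr (star tau E n (set_val x))); split=> [|//|y /nO//];
    [exists (set_val x)|left].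
- move=> x n _ [p ->] /star_classified[i ci].
  by exists i, (star tau E n p).
- move=> x i k n _ _ [G -> cG] [H -> cH] kn y.
  exact: star_class_nested cG cH kn _.
Qed.

End star.

(** * From the countable property of the space to the full property of the subspace *)

Lemma monotonically_metacompact_countably (T : topologicalType) :
  monotonically_metacompact T -> monotonically_countably_metacompact T.
Proof.
move=> [r [rC rM]]; exists r; split=> [U [CU _]|U V [CU _] [CV _]].
  exact: rC.
exact: rM.
Qed.

Theorem corollary1p7 (d : Order.disp_t) (X : orderType d) (tau : topology_on X)
    (Y : set (space_of tau)) :
  is_GO_space tau ->
  (exists2 D : set (order_topology X), dense D & sigma_closed_discrete D) ->
  (monotonically_metacompact (space_of tau) ->
     monotonically_metacompact (set_type Y)) /\
  (monotonically_countably_metacompact (space_of tau) ->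
     monotonically_countably_metacompact (set_type Y)).
Proof.
move=> GO [D Dd [F Fd DF]].
(* One implication, from the weaker property of [X] to the stronger one of [Y], gives both
   claims. *)
suff : monotonically_countably_metacompact (space_of tau) ->
    monotonically_metacompact (set_type Y).
  move=> YC; split=> [/monotonically_metacompact_countably/YC //|/YC].
  exact: monotonically_metacompact_countably.
move=> XC; have tauP := GO_space_ray_convex_opens GO.
have Fo n : @order_discrete d X (F n) by exact: closed_discrete_order_discrete.
have Fb (a b c : X) : a < c -> c < b ->
    exists2 e, (\bigcup_n F n) e & a < e < b.
  by move=> ac cb; rewrite -DF; exact: dense_between cb.
have [R [Rd Rr]] := right_points_discrete tauP Fo Fb XC.
(* The covering property does not mention the order, so [XC] also serves the dual order and yields
   L. *)
have [||L [Ld Lr]] := right_points_discrete (X := X^d) (E := F)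
    (ray_convex_opens_dual tauP) _ _ XC.
- by move=> n; have [] := Fo n.
- move=> a b c ac cb; have [e Ee /andP[be ea]] := Fb _ _ _ cb ac.
  by exists e => //; apply/andP.
pose Q (i : (nat + (nat * nat + nat * nat))%type) : set X :=
  match i with inl n => F n | inr (inl nm) => R nm | inr (inr nm) => L nm end.
have [|E [Ed Em EQ]] := order_discrete_exhaustion (F := Q).
  by move=> [n|[nm|nm]] //=; have [] := Ld nm.
apply: (subspace_monotonically_metacompact tauP Em Ed); rewrite EQ.
- move=> a b c ac cb; have [e [n _ Fe] aeb] := Fb _ _ _ ac cb.
  by exists e => //; exists (inl n).
- by move=> x /Rr[nm _ Rx]; exists (inr (inl nm)).
- by move=> x /Lr[nm _ Lx]; exists (inr (inr nm)).
Qed.
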